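(* Let $Q$ be the rate matrix of an irreducible BD process on $\mathcal{M}=\{0,1\}^k$ ($k\ge1$) that is reversible with respect to its limiting distribution $\pi$, with $\pi(m)>0$ for all $m$. For $\varepsilon>0$ with $\varepsilon\, q_i(m)<1$ for all $i,m$, let $(M^{(s)}_\varepsilon)_{s\ge 0}$ be the homogeneous discrete-time Markov chain with transition matrix $P_\varepsilon$ defined below. Then: (i) $(M^{(s)}_\varepsilon)$ is irreducible and aperiodic, so it has a unique stationary distribution $\pi_\varepsilon$, which is also its limiting distribution. (ii) For any vector norm $\|\cdot\|$ on $\mathbb{R}^{l}$, $\|\pi_\varepsilon-\pi\|=\mathcal{O}(\varepsilon)$ as $\varepsilon\to0$. (iii) For each $m\in\mathcal{M}$, let $W^\varepsilon_m$ be the number of iterations the chain started at $m$ takes to leave $m$ (so $\Pr(W^\varepsilon_m> n)=P_\varepsilon(m,m)^n$ for integers $n\ge0$). Then $\varepsilon W^\varepsilon_m$ converges in distribution as $\varepsilon\to0$ to an exponential random variable with rate $\lambda(m):=\sum_{i=1}^k q_i(m)$, i.e. the holding-time distribution of the BD process in state $m$. (iv) For $m\neq m'$, let $\widetilde P_\varepsilon(m,m')=P_\varepsilon(m,m')/(1-P_\varepsilon(m,m))$ be the probability that the chain moves to $m'$ given that it leaves $m$. Then $\lim_{\varepsilon\to0}\widetilde P_\varepsilon(m,m')=q_i(m)/\lambda(m)$ if $m'=m^i$ for some $i\in\{1,\dots,k\}$, and $\lim_{\varepsilon\to0}\widetilde P_\varepsilon(m,m')=0$ otherwise; these are the jump-chain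 transition probabilities of the BD process.
   Context: $\mathcal{M}=\{0,1\}^k$, $l=2^k$; for $m\in\mathcal{M}$, $m^i$ is $m$ with coordinate $i$ flipped. The BD process is the continuous-time Markov chain with rate matrix $Q(m,m^i)=q_i(m)\ge0$, $Q(m,m)=-\sum_{i=1}^k q_i(m)$, $Q(m,m')=0$ otherwise. Reversibility: $\pi(m)Q(m,m')=\pi(m')Q(m',m)$ for all $m,m'$. For models $m,m'$, $H_{m,m'}$ is the set of coordinates where they differ, and $$P_\varepsilon(m,m')=\prod_{i\in H_{m,m'}} \varepsilon\, q_i(m)\prod_{i\notin H_{m,m'}}\bigl(1-\varepsilon\, q_i(m)\bigr),$$ i.e. from state $m$ each coordinate $i$ is flipped independently with probability $\varepsilon q_i(m)$. Distributions on $\mathcal{M}$ are viewed as row vectors in $\mathbb{R}^l$. *)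

(* Defs.v *)
From HB Require Import structures.
From mathcomp Require Import all_boot all_order all_algebra.
From mathcomp Require Import all_classical all_reals all_analysis.
Set Implicit Arguments. Unset Strict Implicit. Unset Printing Implicit Defensive.
Import Order.TTheory GRing.Theory Num.Theory.
Import numFieldNormedType.Exports.
Local Open Scope classical_set_scope.
Local Open Scope ring_scope.

Section Chains.
Variables (R : realType) (T : finType).

Fixpoint mpow (P : T -> T -> R) (n : nat) : T -> T -> R :=
  match n with
  | O => fun a b => if a == b then 1 else 0
  | S n => fun a b => \sum_(x : T) mpow P n a x * P x b
  end.

(* continuous time: transition function P(t) = exp(t Q), as a real series *)
Definition ct_trans (Q : T -> T -> R) (t : R) (a b : T) : R :=
  limn (fun N => \sum_(n < N) (t ^+ n / (n`!)%:R) * mpow Q n a b).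

Definition ct_irreducible (Q : T -> T -> R) : Prop :=
  forall a b, connect (fun x y => (x != y) && (0 < Q x y)) a b.

Definition ct_limiting (Q : T -> T -> R) (pi : T -> R) : Prop :=
  forall a b, ct_trans Q t a b @[t --> +oo] --> pi b.

Definition reversible (Q : T -> T -> R) (pi : T -> R) : Prop :=
  forall a b, pi a * Q a b = pi b * Q b a.

Definition dt_irreducible (P : T -> T -> R) : Prop :=
  forall a b, connect (fun x y => 0 < P x y) a b.

Definition aperiodic (P : T -> T -> R) : Prop :=
  forall a (d : nat),
    (forall n : nat, (0 < n)%N -> 0 < mpow P n a a -> (d %| n)%N) -> d = 1%N.

Definition stationary (P : T -> T -> R) (p : T -> R) : Prop :=
  [/\ forall a, 0 <= p a, \sum_(a : T) p a = 1 &
      forall b, \sum_(a : T) p a * P a b = p b].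

Definition dt_limiting (P : T -> T -> R) (p : T -> R) : Prop :=
  forall a b, mpow P n a b @[n --> \oo] --> p b.

Definition is_vnorm (N : (T -> R) -> R) : Prop :=
  [/\ forall v, 0 <= N v,
      forall v, N v = 0 -> v = (fun _ => 0),
      forall (c : R) v, N (fun a => c * v a) = `|c| * N v &
      forall v w, N (fun a => v a + w a) <= N v + N w].

End Chains.

Definition bdstate (k : nat) := {ffun 'I_k -> bool}.

Definition flip (k : nat) (m : bdstate k) (i : 'I_k) : bdstate k :=
  [ffun j => if j == i then ~~ m j else m j].

Section BD.
Variables (R : realType) (k : nat) (q : 'I_k -> bdstate k -> R).

Definition lambda (m : bdstate k) : R := \sum_(i < k) q i m.

Definition bdQ (m m' : bdstate k) : R :=
  if m == m' then - lambda m else \sum_(i < k | m' == flip m i) q i m.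

(* P_eps(m,m') : each coordinate flipped independently w.p. eps q_i(m) *)
Definition Peps (eps : R) (m m' : bdstate k) : R :=
  \prod_(i < k) (if m i != m' i then eps * q i m else 1 - eps * q i m).

Definition admissible (eps : R) : Prop :=
  0 < eps /\ forall i m, eps * q i m < 1.

Definition Ptilde (eps : R) (m m' : bdstate k) : R :=
  Peps eps m m' / (1 - Peps eps m m).

End BD.

(* W with Pr(W > n) = p^n (n >= 0), i.e. Pr(W = n) = p^(n-1) - p^n, n >= 1.
   Distribution function of eps * W at x: Pr(eps W <= x). *)
Definition holding_cdf (R : realType) (p eps x : R) : R :=
  \sum_(1 <= n < (Num.truncn (x / eps)).+1) (p ^+ n.-1 - p ^+ n).

Definition exp_cdf (R : realType) (lam x : R) : R :=
  if 0 <= x then 1 - expR (- (lam * x)) else 0.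

(* Main.v *)
Require Import Defs.
From HB Require Import structures.
From mathcomp Require Import all_boot all_order all_algebra.
From mathcomp Require Import all_classical all_reals all_analysis.
From mathcomp Require Import ring.
Import Order.TTheory GRing.Theory Num.Theory.
Import numFieldNormedType.Exports.
Local Open Scope classical_set_scope.
Local Open Scope ring_scope.

(** Everything rests on the expansion P_eps = I + eps Q + O(eps^2): each entry
    of P_eps is a polynomial in eps whose first two coefficients are those of
    I and Q.  Parts (iii) and (iv) follow from it directly, the former by
    squeezing p^n between exp (n (1 - 1/p)) and exp (n (p - 1)).

    A finite stochastic matrix that is irreducible with positive diagonal has a
    positive power, which by Doeblin's minorization is an l1 contraction on
    vectors of total mass 0; this gives (i).  The same contraction, applied to
    the Euler step I + h Q, gives |v| <= c |v Q| for v of total mass 0.  With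
    v = pi_eps - pi, the identities pi Q = 0 and
    eps pi_eps Q = - pi_eps (P_eps - I - eps Q) yield |v Q| = O(eps), hence
    (ii).  That pi has mass 1 comes from its being a limit of rows of exp (t Q),
    as Q has zero row sums. *)

(** * Stochastic matrices acting on row vectors: contraction, stationary laws, norm comparison *)

Section FiniteChains.
Set Implicit Arguments.
Unset Strict Implicit.
Variables (R : realType) (T : finType).
Implicit Types (P : T -> T -> R) (v : T -> R).

Definition vmul v P : T -> R := fun b => \sum_a v a * P a b.
Definition l1 v : R := \sum_a `|v a|.

Definition stochastic P :=
  (forall a b, 0 <= P a b) /\ (forall a, \sum_b P a b = 1).

Lemma l1_ge0 v : 0 <= l1 v.
Proof. exact: sumr_ge0. Qed.

Lemma l1_eq0 v : l1 v <= 0 -> v =1 (fun=> 0).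
Proof.
move=> v0 a; apply/eqP; rewrite -normr_eq0 eq_le normr_ge0 andbT.
by apply: le_trans v0; rewrite /l1 (bigD1 a)//= lerDl sumr_ge0.
Qed.

Lemma norm_le_l1 v a : `|v a| <= l1 v.
Proof. by rewrite /l1 (bigD1 a)//= lerDl sumr_ge0. Qed.

Lemma l1D v w : l1 (fun a => v a + w a) <= l1 v + l1 w.
Proof. by rewrite /l1 -big_split/=; apply: ler_sum => a _; exact: ler_normD. Qed.

Lemma sum_vmul v P : stochastic P -> \sum_b vmul v P b = \sum_a v a.
Proof.
move=> [_ P1]; rewrite exchange_big/=; apply: eq_bigr => a _.
by rewrite -mulr_sumr P1 mulr1.
Qed.

(* Doeblin's minorization: subtracting a constant from every entry does not
   change the action on a vector of total mass 0. *)
Lemma l1_vmul_minor v P (d : R) : (forall a b, d <= P a b) ->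
  (forall a, \sum_b P a b = 1) -> \sum_a v a = 0 ->
  l1 (vmul v P) <= (1 - d *+ #|T|) * l1 v.
Proof.
move=> dP P1 v0.
have vE b : vmul v P b = \sum_a v a * (P a b - d).
  rewrite /vmul; under [RHS]eq_bigr do rewrite mulrBr.
  by rewrite sumrB -mulr_suml v0 mul0r subr0.
rewrite /l1; under eq_bigr do rewrite vE.
apply: (@le_trans _ _ (\sum_b \sum_a `|v a| * (P a b - d))).
  apply: ler_sum => b _; apply: le_trans (ler_norm_sum _ _ _) _.
  by apply: ler_sum => a _; rewrite normrM (ger0_norm (x := P a b - d))// subr_ge0.
rewrite exchange_big mulr_sumr/=; apply: ler_sum => a _.
by rewrite -mulr_sumr sumrB P1 sumr_const mulrC.
Qed.

Lemma l1_vmul v P : stochastic P -> l1 (vmul v P) <= l1 v.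
Proof.
move=> [P0 P1]; rewrite /l1.
apply: (@le_trans _ _ (\sum_b \sum_a `|v a| * P a b)).
  apply: ler_sum => b _; apply: le_trans (ler_norm_sum _ _ _) _.
  by apply: ler_sum => a _; rewrite normrM (ger0_norm (P0 a b)).
rewrite exchange_big/=; apply: ler_sum => a _.
by rewrite -mulr_sumr P1 mulr1.
Qed.

Lemma vmul_mpow0 v P : vmul v (mpow P 0) = v.
Proof.
apply/funext => b; rewrite /vmul /= (bigD1 b)//= eqxx mulr1 big1 ?addr0// => a.
by move=> /negPf ->; rewrite mulr0.
Qed.

Lemma vmul_mpowS v P n : vmul v (mpow P n.+1) = vmul (vmul v (mpow P n)) P.
Proof.
apply/funext => b; rewrite /vmul /=.
under eq_bigr do rewrite mulr_sumr.
rewrite exchange_big/=; apply: eq_bigr => c _.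
by rewrite mulr_suml; apply: eq_bigr => a _; rewrite mulrA.
Qed.

Lemma vmul_mpowD v P m n :
  vmul v (mpow P (m + n)) = vmul (vmul v (mpow P m)) (mpow P n).
Proof.
elim: n => [|n IH]; first by rewrite addn0 vmul_mpow0.
by rewrite addnS !vmul_mpowS IH.
Qed.

Lemma stochastic_mpow P n : stochastic P -> stochastic (mpow P n).
Proof.
move=> [P0 P1]; elim: n => [|n [IH0 IH1]]; split=> [a b|a] /=.
- by case: eqP.
- rewrite (bigD1 a)//= eqxx big1 ?addr0// => b.
  by rewrite eq_sym => /negPf ->.
- by apply: sumr_ge0 => c _; rewrite mulr_ge0.
- rewrite exchange_big/= -[RHS](IH1 a); apply: eq_bigr => c _.
  by rewrite -mulr_sumr P1 mulr1.
Qed.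

Lemma mpow_gt0_step P n a b c : stochastic P ->
  0 < mpow P n a b -> 0 < P b c -> 0 < mpow P n.+1 a c.
Proof.
move=> sP ab bc /=; rewrite (bigD1 b)//= ltr_pwDl ?mulr_gt0//.
by apply: sumr_ge0 => x _; rewrite mulr_ge0// ?(stochastic_mpow n sP).1 ?sP.1.
Qed.

(** A positive diagonal lets a path wait at its endpoint for the extra [n - m] steps. *)
Lemma mpow_gt0_leq P m n a b : stochastic P -> (forall c, 0 < P c c) ->
  (m <= n)%N -> 0 < mpow P m a b -> 0 < mpow P n a b.
Proof.
move=> sP dP /subnKC <-; elim: (n - m)%N => [|j IH]; first by rewrite addn0.
by move=> /IH ab; rewrite addnS; apply: (mpow_gt0_step sP ab).
Qed.

(** A path from [a] to [b] makes some power positive at that entry; the largest exponent over the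
    finitely many pairs serves all of them, since paths may wait. *)
Lemma mpow_primitive P : stochastic P -> (forall a, 0 < P a a) ->
  dt_irreducible P -> exists N, forall a b, 0 < mpow P N a b.
Proof.
move=> sP dP iP.
have ab (u : T * T) : exists n, 0 < mpow P n u.1 u.2.
  case: u => a b; have /connectP[p pP ->] /= := iP a b.
  elim/last_ind: p pP => [_|p x IH]; first by exists 0%N; rewrite /= eqxx.
  rewrite rcons_path last_rcons => /andP[/IH[n n0] px].
  by exists n.+1; apply: mpow_gt0_step n0 px.
have [f fP] := fin_all_exists ab.
exists (\max_u f u) => a b; apply: mpow_gt0_leq (fP (a, b)) => //.
exact: (leq_bigmax (a, b)).
Qed.

Lemma contraction P : stochastic P -> (forall a, 0 < P a a) ->
  dt_irreducible P -> exists N (rho : R), 0 <= rho < 1 /\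
    forall v, \sum_a v a = 0 -> l1 (vmul v (mpow P N)) <= rho * l1 v.
Proof.
move=> sP dP iP; have [N NP] := mpow_primitive sP dP iP.
have [a0|T0] := pickP (@predT T); last first.
  exists N, 0; split=> [|v _]; first by rewrite lexx ltr01.
  by rewrite mul0r /l1 big1// => a; have := T0 a.
(* The smallest entry of P^N; the default 1 of the minimum keeps it positive. *)
move=> _; pose d : R := \big[Order.min/1]_(u : T * T) mpow P N u.1 u.2.
have d0 : 0 < d by apply: lt_bigmin => // u _; exact: NP.
have dle a b : d <= mpow P N a b by apply: (bigmin_le_cond _ (j := (a, b))).
have [_ P1] := stochastic_mpow N sP.
exists N, (1 - d *+ #|T|); split=> [|v]; last exact: l1_vmul_minor.
apply/andP; split.
  (* A row of P^N sums to 1 and each of its entries is at least [d]. *)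
  by rewrite subr_ge0 -(P1 a0) -sumr_const; exact: ler_sum.
by rewrite gtrBl pmulrn_lgt0//; apply/card_gt0P; exists a0.
Qed.

(** The l1 norm decays geometrically along multiples of N and does not increase in between. *)
Lemma l1_vmul_mpow_cvg0 P v : stochastic P -> (forall a, 0 < P a a) ->
  dt_irreducible P -> \sum_a v a = 0 ->
  l1 (vmul v (mpow P n)) @[n --> \oo] --> 0.
Proof.
move=> sP dP iP v0; have [N [rho [/andP[r0 r1] cN]]] := contraction sP dP iP.
have pow j : l1 (vmul v (mpow P (j * N))) <= rho ^+ j * l1 v.
  elim: j => [|j IH]; first by rewrite mul0n vmul_mpow0 expr0 mul1r.
  rewrite mulSn addnC vmul_mpowD exprS -mulrA.
  apply: le_trans (cN _ _) _; last exact: ler_wpM2l.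
  by rewrite sum_vmul//; exact: stochastic_mpow.
apply/cvgr0Pnorm_lt => e e0.
have : rho ^+ j * l1 v @[j --> \oo] --> 0.
  rewrite -[X in _ --> X](mul0r (l1 v)); apply: cvgMl.
  by apply: cvg_expr; rewrite ger0_norm.
move=> /cvgr0Pnorm_lt/(_ e e0)[j _ /(_ j (leqnn j)) je].
exists (j * N)%N => // n /= /subnKC <-.
rewrite ger0_norm ?l1_ge0// vmul_mpowD.
apply: le_lt_trans (l1_vmul _ (stochastic_mpow _ sP)) _.
exact: le_lt_trans (pow j) (le_lt_trans (ler_norm _) je).
Qed.

(* Telescoping v - v P^N bounds it by N |v P - v|, and P^N is a contraction. *)
Lemma l1_le_residual P : stochastic P -> (forall a, 0 < P a a) ->
  dt_irreducible P -> exists2 c : R, 0 <= c & forall v, \sum_a v a = 0 ->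
    l1 v <= c * l1 (fun b => vmul v P b - v b).
Proof.
move=> sP dP iP; have [N [rho [/andP[r0 r1] cN]]] := contraction sP dP iP.
exists (N%:R / (1 - rho)) => [|v v0].
  by rewrite divr_ge0// subr_ge0 ltW.
set w := fun b => _.
have wn n : l1 (fun b => vmul v (mpow P n) b - v b) <= n%:R * l1 w.
  elim: n => [|n IH].
    by rewrite mul0r vmul_mpow0 /l1 big1// => b _; rewrite subrr normr0.
  have -> : (fun b => vmul v (mpow P n.+1) b - v b) =
      (fun b => vmul (fun a => vmul v (mpow P n) a - v a) P b + w b).
    apply/funext => b; rewrite vmul_mpowS /w addrA; congr (_ - _).
    rewrite /vmul -big_split/=; apply: eq_bigr => a _.
    by rewrite -mulrDl subrK.
  apply: le_trans (l1D _ _) _; rewrite -natr1 mulrDl mul1r lerD2r.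
  exact: le_trans (l1_vmul _ sP) IH.
rewrite mulrAC ler_pdivlMr ?subr_gt0// mulrBr mulr1 lerBlDr [_ * rho]mulrC.
apply: le_trans (lerD (wn N) (cN v v0)); rewrite /l1 -big_split/=.
(* Entrywise, v = v P^N - (v P^N - v). *)
apply: ler_sum => b _; rewrite -[X in `|X| <= _](subKr (vmul v (mpow P N) b)).
by rewrite addrC; exact: ler_normB.
Qed.

Lemma stationary_mpow P p n : stationary P p -> vmul p (mpow P n) = p.
Proof.
move=> [_ _ pP]; elim: n => [|n IH]; first exact: vmul_mpow0.
by rewrite vmul_mpowS IH; apply/funext.
Qed.

Lemma vmulBl v w P :
  vmul (fun a => v a - w a) P = (fun b => vmul v P b - vmul w P b).
Proof.
by apply/funext => b; rewrite -sumrB; apply: eq_bigr => a _; rewrite mulrBl.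
Qed.

Lemma sum_indic (a : T) (f : T -> R) :
  \sum_x (if a == x then 1 else 0) * f x = f a.
Proof.
rewrite (bigD1 a)//= eqxx mul1r big1 ?addr0// => x.
by rewrite eq_sym => /negPf ->; rewrite mul0r.
Qed.

(** The vector delta_a - p has mass 0, and its image under P^n is row [a] of P^n minus [p]. The sign
    of [p] is left open so that [stationary_exists] can deduce nonnegativity from this limit. *)
Lemma mpow_cvg_fixed P p : stochastic P -> (forall a, 0 < P a a) ->
  dt_irreducible P -> \sum_a p a = 1 -> (forall n, vmul p (mpow P n) = p) ->
  dt_limiting P p.
Proof.
move=> sP dP iP p1 pP a b; apply/subr_cvg0/norm_cvg0P.
pose v x := (if a == x then 1 else 0) - p x.
have v0 : \sum_x v x = 0.
  rewrite sumrB p1 -[X in X - _](_ : 1 = _) ?subrr//.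
  by rewrite -[LHS](sum_indic a (fun=> 1)); under eq_bigr do rewrite mulr1.
apply: squeeze_cvgr (cvg_cst 0) (l1_vmul_mpow_cvg0 sP dP iP v0).
apply: nearW => n; rewrite normr_ge0/=.
have -> : mpow P n a b - p b = vmul v (mpow P n) b.
  by rewrite vmulBl pP /= /vmul sum_indic.
exact: norm_le_l1.
Qed.

(** P - I annihilates the constant column, which is nonzero because [a0] inhabits [T]; so P - I is
    singular and has a nonzero left kernel vector. States are enumerated to obtain a genuine square
    matrix. *)
Lemma vmul_fixed_exists P (a0 : T) : stochastic P ->
  exists2 v : T -> R, vmul v P =1 v & exists a, v a != 0.
Proof.
move=> [_ P1].
pose A : 'M[R]_#|T| := \matrix_(i, j) (P (enum_val i) (enum_val j) - (i == j)%:R).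
have A1 : A *m const_mx 1 = 0 :> 'cV_#|T|.
  apply/matrixP => i j; rewrite !mxE.
  under eq_bigr do rewrite !mxE mulr1.
  have -> : \sum_l (P (enum_val i) (enum_val l) - (i == l)%:R) =
      \sum_b P (enum_val i) b - 1.
    rewrite sumrB; congr (_ - _).
      rewrite [RHS](reindex_onto enum_val enum_rank) /=.
        by apply: eq_bigl => l; rewrite enum_valK eqxx.
      by move=> l _; rewrite enum_rankK.
    rewrite (bigD1 i)//= eqxx big1 ?addr0// => l.
    by rewrite eq_sym => /negPf ->.
  by rewrite P1 subrr.
have detA : \det A == 0.
  rewrite -[_ == 0]negbK -unitfE -/(A \in unitmx); apply/negP => uA.
  have /matrixP/(_ (enum_rank a0) 0) := congr1 (mulmx (invmx A)) A1.
  by rewrite mulKmx// mulmx0 !mxE => /eqP; rewrite oner_eq0.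
have /det0P[u u0 uA] := detA.
exists (fun a => u 0 (enum_rank a)).
  move=> b; apply/eqP; rewrite -subr_eq0; apply/eqP.
  have /matrixP/(_ 0 (enum_rank b)) := uA; rewrite !mxE => uAb.
  rewrite -[RHS]uAb; under [RHS]eq_bigr do rewrite mxE mulrBr.
  rewrite sumrB; congr (_ - _).
    rewrite /vmul (reindex_onto enum_val enum_rank) /=.
      by apply: eq_big => [l|l _]; rewrite ?enum_valK ?enum_rankK ?eqxx.
    by move=> l _; rewrite enum_rankK.
  rewrite (bigD1 (enum_rank b))//= eqxx mulr1 big1 ?addr0// => l /negPf ->.
  by rewrite mulr0.
apply: contrapT => nex; move: u0; apply/negP/negPn/eqP/rowP => i; rewrite mxE.
apply: contrapT => /eqP ui; apply: nex; exists (enum_val i).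
by rewrite enum_valK.
Qed.

Lemma stationary_exists P (a0 : T) : stochastic P -> (forall a, 0 < P a a) ->
  dt_irreducible P -> exists p, stationary P p.
Proof.
move=> sP dP iP; have [v vP [a va]] := vmul_fixed_exists a0 sP.
have [c _ cP] := l1_le_residual sP dP iP.
(* With mass 0, the residual bound would force the nonzero fixed vector [v] to vanish; hence it can
   be normalized. *)
have vs : \sum_a v a != 0.
  apply/eqP => /cP; rewrite [X in _ <= _ * X](_ : _ = 0); last first.
    by rewrite /l1 big1// => b _; rewrite vP subrr normr0.
  by rewrite mulr0 => /l1_eq0/(_ a)/eqP; rewrite (negPf va).
pose p b := v b / \sum_a v a.
have p1 : \sum_b p b = 1 by rewrite -mulr_suml divff.
have pP b : vmul p P b = p b.
  by rewrite /p -[v b]vP /vmul mulr_suml; apply: eq_bigr => x _; rewrite mulrAC.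
have pPn n : vmul p (mpow P n) = p.
  elim: n => [|n IH]; first exact: vmul_mpow0.
  by rewrite vmul_mpowS IH; apply/funext.
exists p; split => // b.
(* Nonnegativity of [p] comes from its being a limit of entries of powers of P. *)
have pb : mpow P n a0 b @[n --> \oo] --> p b by apply: mpow_cvg_fixed.
rewrite -(cvg_lim _ pb)//; apply: limr_ge; first exact: cvgP pb.
by apply: nearW => n; exact: (stochastic_mpow n sP).1.
Qed.

Lemma stationary_unique P p p' : stochastic P -> (forall a, 0 < P a a) ->
  dt_irreducible P -> stationary P p -> stationary P p' -> p = p'.
Proof.
move=> sP dP iP sp sp'; apply/funext => b.
have lim_of r : stationary P r -> limn (fun n => mpow P n b b) = r b.
  move=> sr; apply: cvg_lim => //; apply: (mpow_cvg_fixed sP dP iP) => [|n].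
    by case: sr.
  exact: stationary_mpow.
by rewrite -(lim_of _ sp) (lim_of _ sp').
Qed.

(** Expand [v] in the standard basis; K is the sum of the norms of the basis vectors. This carries
    the l1 estimate over to any norm. *)
Lemma vnorm_le_l1 (N : (T -> R) -> R) : is_vnorm N ->
  exists2 K : R, 0 <= K & forall v, N v <= K * l1 v.
Proof.
move=> [N0 _ NZ ND]; pose e (a b : T) : R := (a == b)%:R.
exists (\sum_a N (e a)) => [|v]; first exact: sumr_ge0.
have vE : v = (fun b => \sum_a v a * e a b).
  apply/funext => b; rewrite (bigD1 b)//= /e eqxx mulr1 big1 ?addr0// => a.
  by move=> /negPf ->; rewrite mulr0.
(* The triangle inequality for two terms is extended by induction over an arbitrary list of states;
   the empty list uses N 0 = 0, from homogeneity at c = 0. *)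
have sN s : N (fun b => \sum_(a <- s) v a * e a b) <= \sum_(a <- s) `|v a| * N (e a).
  elim: s => [|a s IH].
    rewrite big_nil; have N00 : N (fun a => 0 * v a) = 0 by rewrite NZ normr0 mul0r.
    rewrite -[leRHS]N00 le_eqVlt; apply/orP; left; apply/eqP.
    by congr N; apply/funext => b; rewrite big_nil mul0r.
  rewrite big_cons -NZ; apply: le_trans (lerD (lexx _) IH).
  apply: le_trans (ND _ _); rewrite le_eqVlt; apply/orP; left; apply/eqP.
  by congr N; apply/funext => b; rewrite big_cons.
rewrite {1}vE; apply: le_trans (sN _) _; rewrite mulr_suml.
by apply: ler_sum => a _; rewrite mulrC ler_wpM2l//; exact: norm_le_l1.
Qed.

End FiniteChains.

(** * The series exp (t Q) and its row sums *)

Section ExpSemigroup.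
Set Implicit Arguments.
Unset Strict Implicit.
Variables (R : realType) (T : finType).
Implicit Type Q : T -> T -> R.

(** [ct_trans] is a [limn], informative only once convergence is known. With K the sum of all |Q x
    y|, entries of Q^n are at most K^n, so the exponential series of |t| K dominates. *)
Lemma cvg_ct_trans Q t a b :
  \sum_(n < N) (t ^+ n / n`!%:R) * mpow Q n a b @[N --> \oo] --> ct_trans Q t a b.
Proof.
pose u n := (t ^+ n / n`!%:R) * mpow Q n a b.
have uE : (fun N => \sum_(n < N) u n) = series u.
  by apply/funext => N; rewrite /series /= big_mkord.
rewrite /ct_trans uE; apply: normed_cvg.
pose K : R := \sum_x \sum_y `|Q x y|.
have K0 : 0 <= K by apply: sumr_ge0 => x _; apply: sumr_ge0.
have QK n c d : `|mpow Q n c d| <= K ^+ n.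
  elim: n d => [|n IH] d /=; first by case: eqP; rewrite ?normr1 ?normr0 ?expr0.
  apply: le_trans (ler_norm_sum _ _ _) _; rewrite exprSr mulr_sumr.
  apply: ler_sum => x _; rewrite normrM; apply: ler_pM => //.
  by rewrite (bigD1 d)//= lerDl sumr_ge0.
apply: (@series_le_cvg _ _ (exp_coeff (`|t| * K))) => [n|n|n|].
- exact: normr_ge0.
- by apply: exp_coeff_ge0; rewrite mulr_ge0.
- rewrite /u /exp_coeff /= !normrM normrX normfV [`|n`!%:R|]ger0_norm//.
  by rewrite exprMn mulrAC ler_wpM2r ?invr_ge0// ler_wpM2l// exprn_ge0.
- exact: is_cvg_series_exp_coeff.
Qed.

Lemma cvg_sum_fin {U : Type} (F : set_system U) {FF : Filter F}
    (f : T -> U -> R) (l : T -> R) :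
  (forall a, f a x @[x --> F] --> l a) ->
  \sum_a f a x @[x --> F] --> \sum_a l a.
Proof. by move=> fl; apply: cvg_big => [|//] ; exact: add_continuous. Qed.

(** Rows of Q^n sum to 0 for n >= 1, so only the term n = 0 contributes. *)
Lemma sum_ct_trans Q t a : (forall x, \sum_y Q x y = 0) ->
  \sum_b ct_trans Q t a b = 1.
Proof.
move=> Q0.
have cs :
  \sum_b \sum_(n < N) (t ^+ n / n`!%:R) * mpow Q n a b @[N --> \oo] -->
    \sum_b ct_trans Q t a b.
  by apply: cvg_sum_fin => b; exact: cvg_ct_trans.
rewrite -(cvg_lim _ cs)//; apply: cvg_lim => //.
have mQ n : \sum_b mpow Q n a b = (n == 0%N)%:R.
  case: n => [|n] /=.
    rewrite -[RHS](sum_indic a (fun=> 1)).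
    by apply: eq_bigr => b _; rewrite mulr1.
  by rewrite exchange_big big1// => x _; rewrite -mulr_sumr Q0 mulr0.
(* The partial sum at N = 0 is empty; from N = 1 on the row sum equals 1. *)
apply: cvg_near_cst; exists 1%N => // -[//|N] _.
rewrite exchange_big /=; under eq_bigr do rewrite -mulr_sumr mQ.
rewrite big_ord_recl /= expr0 fact0 divr1 mulr1 big1 ?addr0// => i _.
by rewrite mulr0.
Qed.

Lemma ct_limiting_sum Q p (a0 : T) : (forall x, \sum_y Q x y = 0) ->
  ct_limiting Q p -> \sum_b p b = 1.
Proof.
move=> Q0 lp; have cs : \sum_b ct_trans Q t a0 b @[t --> +oo] --> \sum_b p b.
  by apply: cvg_sum_fin => b; exact: lp.
rewrite -(cvg_lim _ cs)//; apply: cvg_lim => //.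
by apply: cvg_near_cst; apply: nearW => t; exact: sum_ct_trans.
Qed.

End ExpSemigroup.

(** * First-order expansion of polynomials at 0 *)

Section Linearization.
Set Implicit Arguments.
Unset Strict Implicit.
Variable R : realType.

(** The remainder is e^2 times [drop_poly 2 p] at [e], and on [0, 1] a polynomial is bounded by the
    sum of its absolute coefficients. *)
Lemma poly_linear_approx (p : {poly R}) (e : R) : 0 <= e <= 1 ->
  `|p.[e] - p`_0 - e * p`_1| <=
    (\sum_(i < size (drop_poly 2 p)) `|(drop_poly 2 p)`_i|) * e ^+ 2.
Proof.
move=> /andP[e0 e1]; set r := drop_poly 2 p.
have -> : p.[e] - p`_0 - e * p`_1 = r.[e] * e ^+ 2.
  rewrite -[in p.[e]](poly_take_drop 2 p) hornerD hornerM hornerXn.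
  rewrite (horner_coef_wide _ (size_take_poly 2 p)) !big_ord_recl big_ord0 /=.
  by rewrite !coef_take_poly /= expr0 expr1; ring.
rewrite normrM [`|e ^+ 2|]ger0_norm ?exprn_ge0// ler_wpM2r ?exprn_ge0//.
rewrite horner_coef; apply: le_trans (ler_norm_sum _ _ _) _.
apply: ler_sum => i _; rewrite normrM ler_piMr//.
by rewrite ger0_norm ?exprn_ge0// exprn_ile1.
Qed.

(** The product rule at 0. Uniqueness matters because the inner product drops [i] by value, not by
    position. *)
Lemma coef1_prod_linear (I : eqType) (x y : I -> R) (s : seq I) : uniq s ->
  (\prod_(i <- s) ((x i)%:P + y i *: 'X))`_1 =
  \sum_(i <- s) y i * \prod_(j <- s | j != i) x j.
Proof.
pose F i : {poly R} := (x i)%:P + y i *: 'X.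
have F0 i : (F i)`_0 = x i by rewrite coefD coefC coefZ coefX mulr0 addr0.
have F1 i : (F i)`_1 = y i by rewrite coefD coefC coefZ coefX mulr1 add0r.
elim: s => [|a s IH] /=; first by rewrite !big_nil coef1.
move=> /andP[as_ us]; rewrite !big_cons coefM !big_ord_recl big_ord0 /=.
rewrite -!/(F _) F0 F1 (IH us) addr0 addrC eqxx /= coef0_prod; congr (_ * _ + _).
  rewrite big_seq_cond [RHS]big_seq_cond; apply: eq_big => [j|j _]; last exact: F0.
  rewrite andbT; case: (boolP (j \in s)) => //= js.
  by apply/esym; apply: contraNneq as_ => <-.
rewrite mulr_sumr [LHS]big_seq [RHS]big_seq; apply: eq_bigr => i is_.
rewrite big_cons ifT; first by rewrite mulrCA.
by apply: contraNneq as_ => ->.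
Qed.

End Linearization.

(** * Expansion of P_eps around the identity, and the limiting jump probabilities *)

Section BirthDeath.
Set Implicit Arguments.
Unset Strict Implicit.
Variables (R : realType) (k : nat) (q : 'I_k -> bdstate k -> R).
Implicit Types m : bdstate k.

Lemma flip_neq m i : flip m i != m.
Proof. by apply/eqP => /ffunP/(_ i); rewrite ffunE eqxx; case: (m i). Qed.

Lemma flip_inj m : injective (flip m).
Proof.
move=> i j /ffunP/(_ i); rewrite !ffunE eqxx.
by case: (eqVneq i j) => // _; case: (m i).
Qed.

Lemma bdQ_flip m i : bdQ q m (flip m i) = q i m.
Proof.
rewrite /bdQ eq_sym (negPf (flip_neq m i)) (big_pred1 i)// => j.
by rewrite eq_sym (inj_eq (@flip_inj m)).
Qed.

Lemma bdQ_nonneighbour m m' :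
  m' != m -> (forall i, m' != flip m i) -> bdQ q m m' = 0.
Proof.
move=> mm' nf; rewrite /bdQ eq_sym (negPf mm') big1// => i.
by rewrite (negPf (nf i)).
Qed.

Lemma bdQ_sum m : \sum_m' bdQ q m m' = 0.
Proof.
rewrite (bigD1 m)//= {1}/bdQ eqxx /lambda.
apply/eqP; rewrite addrC subr_eq0; apply/eqP.
under eq_bigr => m' m'm do rewrite /bdQ eq_sym (negPf m'm) big_mkcond.
rewrite exchange_big/=; apply: eq_bigr => i _.
rewrite -big_mkcondr (big_pred1 (flip m i))// => m'.
by rewrite /=; case: (eqVneq m' (flip m i)) => [->|]; rewrite ?flip_neq ?andbF.
Qed.

(** Expanding the product over coordinates of (eps q_i + (1 - eps q_i)) gives one term per target
    state. *)
Lemma Peps_sum e m : \sum_m' Peps q e m m' = 1.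
Proof.
rewrite /Peps -(bigA_distr_bigA (fun i (b : bool) =>
  if m i != b then e * q i m else 1 - e * q i m)).
rewrite big1// => i _; rewrite big_bool.
by case: (m i) => /=; rewrite ?subrK // addrC subrK.
Qed.

Lemma Peps_approx : exists2 C : R, 0 <= C &
  forall e, 0 <= e <= 1 -> forall m m',
    `|Peps q e m m' - (m == m')%:R - e * bdQ q m m'| <= C * e ^+ 2.
Proof.
pose x m m' i : R := (m i == m' i)%:R.
pose y m m' i : R := if m i != m' i then q i m else - q i m.
pose p m m' : {poly R} :=
  \prod_(i <- index_enum 'I_k) ((x m m' i)%:P + y m m' i *: 'X).
have pE e m m' : (p m m').[e] = Peps q e m m'.
  rewrite /p horner_prod; apply: eq_bigr => i _.
  rewrite hornerD hornerC hornerZ hornerX /x /y.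
  by case: (m i == m' i); rewrite /= ?mulNr ?add0r mulrC.
have p0 m m' : (p m m')`_0 = (m == m')%:R.
  rewrite coef0_prod.
  under eq_bigr do rewrite coefD coefC coefZ coefX mulr0 addr0 /=.
  case: (eqVneq m m') => [->|mm']; first by rewrite big1// => i _; rewrite /x eqxx.
  have [i mi] : exists i, m i != m' i.
    apply: contrapT => nex; move/eqP: mm'; apply; apply/ffunP => i.
    by apply: contrapT => /eqP mi; apply: nex; exists i.
  by rewrite (bigD1 i)//= /x (negPf mi) mul0r.
have p1 m m' : (p m m')`_1 = bdQ q m m'.
  rewrite coef1_prod_linear ?index_enum_uniq// /bdQ.
  case: (eqVneq m m') => [<-|mm'].
    rewrite /lambda -sumrN; apply: eq_bigr => i _.
    by rewrite big1 ?mulr1 /y ?eqxx// => j _; rewrite /x eqxx.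
  rewrite [RHS]big_mkcond; apply: eq_bigr => i _.
  case: eqVneq => [->|mf].
    rewrite big1 ?mulr1 /y => [|j ji].
      by rewrite ffunE eqxx; case: (m i).
    by rewrite /x ffunE (negPf ji) eqxx.
  (* Here [m'] is neither [m] nor [flip m i], so it differs from [m] at another coordinate, whose
     constant factor 0 kills the i-th term. *)
  have [j /andP[ji mj]] : exists j, (j != i) && (m j != m' j).
    apply: contrapT => nex.
    have agree j : j != i -> m' j = m j.
      move=> ji; apply: contrapT => mj; apply: nex; exists j.
      by rewrite ji /=; apply/eqP => mj'; exact: mj.
    have [mi|mi] := eqVneq (m i) (m' i).
      move/eqP: mm'; apply; apply/ffunP => j.
      by have [->//|/agree ->] := eqVneq j i.
    move/eqP: mf; apply; apply/ffunP => j; rewrite ffunE.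
    have [->|/agree ->//] := eqVneq j i.
    by move: mi; case: (m i); case: (m' i).
  by rewrite (bigD1 j)//= /x (negPf mj) mul0r mulr0.
(* Summing these constants over all pairs of states makes the bound uniform. *)
pose C m m' := \sum_(i < size (drop_poly 2 (p m m'))) `|(drop_poly 2 (p m m'))`_i|.
have C0 m m' : 0 <= C m m' by exact: sumr_ge0.
exists (\sum_m \sum_m' C m m') => [|e e01 m m'].
  by apply: sumr_ge0 => m _; exact: sumr_ge0.
rewrite -pE -p0 -p1; apply: le_trans (poly_linear_approx _ e01) _.
rewrite ler_wpM2r ?exprn_ge0//; first by case/andP: e01.
rewrite (bigD1 m)//= (bigD1 m')//= -!addrA lerDl addr_ge0 ?sumr_ge0// => m'' _.
exact: sumr_ge0.
Qed.

Lemma near_right01 : \forall e \near (0 : R)^'+, 0 < e <= 1.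
Proof.
near=> e; apply/andP; split; near: e; first exact: nbhs_right_gt.
by apply: nbhs_right_le.
Unshelve. all: by end_near. Qed.

Lemma id_cvg_right0 : e @[e --> (0 : R)^'+] --> 0.
Proof. exact: cvg_at_right_filter cvg_id. Qed.

Lemma Peps_slope m m' :
  (Peps q e m m' - (m == m')%:R) / e @[e --> 0^'+] --> bdQ q m m'.
Proof.
have [C C0 CP] := Peps_approx; apply/subr_cvg0/norm_cvg0P.
apply: (@squeeze_cvgr _ _ _ _ (fun=> 0) (fun e => C * e)).
- near=> e; rewrite normr_ge0/=.
  have /andP[e0 e1] : 0 < e <= 1 by near: e; exact: near_right01.
  have -> : (Peps q e m m' - (m == m')%:R) / e - bdQ q m m' =
      (Peps q e m m' - (m == m')%:R - e * bdQ q m m') / e.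
    by field; rewrite gt_eqF.
  rewrite normrM normfV (gtr0_norm e0) ler_pdivrMr// -mulrA -expr2.
  by rewrite CP// ltW.
- exact: cvg_cst.
- by rewrite -[X in _ --> X](mulr0 C); apply: cvgM id_cvg_right0; exact: cvg_cst.
Unshelve. all: by end_near. Qed.

Lemma Peps_diag_cvg1 m : Peps q e m m @[e --> 0^'+] --> (1 : R).
Proof.
apply/subr_cvg0.
have : (Peps q e m m - (m == m)%:R) / e * e @[e --> 0^'+] --> bdQ q m m * 0.
  by apply: cvgM id_cvg_right0; exact: Peps_slope.
rewrite mulr0; apply: cvg_trans; apply: near_eq_cvg.
near=> e.
have e0 : 0 < e by near: e; exact: nbhs_right_gt.
by rewrite eqxx divfK// gt_eqF.
Unshelve. all: by end_near. Qed.

(** Dividing numerator and denominator by eps turns the ratio into a quotient of slopes, the lower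
    one tending to lambda(m). *)
Lemma Ptilde_cvg m m' : m' != m -> 0 < lambda q m ->
  Ptilde q e m m' @[e --> 0^'+] --> bdQ q m m' / lambda q m.
Proof.
move=> m'm l0.
have Qmm : bdQ q m m = - lambda q m by rewrite /bdQ eqxx.
have /cvgN := @Peps_slope m m; rewrite Qmm opprK => sm.
apply: cvg_trans (cvgM (@Peps_slope m m') (cvgV (lt0r_neq0 l0) sm)).
apply: near_eq_cvg; near=> e.
have e0 : e != 0 by rewrite gt_eqF//; near: e; exact: nbhs_right_gt.
rewrite /= /Ptilde eqxx eq_sym (negPf m'm) subr0.
by rewrite -mulNr opprB invf_div mulrA divfK.
Unshelve. all: by end_near. Qed.

End BirthDeath.

(** * Geometric holding times and their exponential limit *)

Section Holding.
Set Implicit Arguments.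
Unset Strict Implicit.
Variable R : realType.

Lemma holding_cdfE (p e x : R) : holding_cdf p e x = 1 - p ^+ Num.truncn (x / e).
Proof.
rewrite /holding_cdf big_add1 /=.
rewrite (@telescope_sumr_eq _ _ _ (fun n => - p ^+ n))// => [|n _].
  by rewrite expr0 opprK addrC.
by rewrite opprK addrC.
Qed.

(** The truncation n of x / e satisfies n e <= x < n e + e, so the error is below e. *)
Lemma truncn_mul_cvg (x : R) : 0 <= x ->
  (Num.truncn (x / e))%:R * e @[e --> 0^'+] --> x.
Proof.
move=> x0; apply/subr_cvg0/norm_cvg0P.
apply: (@squeeze_cvgr _ _ _ _ (fun=> 0) id); [|exact: cvg_cst|exact: id_cvg_right0].
near=> e.
have e0 : 0 < e by near: e; exact: nbhs_right_gt.
have /andP[] := truncn_itv (divr_ge0 x0 (ltW e0)).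
rewrite ler_pdivlMr// ltr_pdivrMr// -natr1 mulrDl mul1r => lo hi.
rewrite normr_ge0 ler0_norm ?subr_le0// opprB lerBlDl /=; exact: ltW.
Unshelve. all: by end_near. Qed.

(* 1 + t <= exp t, applied to t = p - 1 and t = 1/p - 1 *)
Lemma expr_exp_bounds (p : R) n : 0 < p ->
  expR (n%:R * ((p - 1) / p)) <= p ^+ n <= expR (n%:R * (p - 1)).
Proof.
move=> p0; rewrite !expRM_natl; apply/andP; split.
  rewrite lerXn2r ?nnegrE ?expR_ge0 ?(ltW p0)//.
  rewrite mulrBl divff ?gt_eqF// mul1r -[1 - _]opprB expRN invf_ple ?posrE ?expR_gt0//.
  by have := expR_ge1Dx (p^-1 - 1); rewrite addrC subrK.
rewrite lerXn2r ?nnegrE ?expR_ge0 ?(ltW p0)//.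
by have := expR_ge1Dx (p - 1); rewrite addrC subrK.
Qed.

(** Both exponents of the squeeze tend to - l x: n e tends to x, (p - 1) / e to - l, and the extra
    division by p in the lower one is harmless as p tends to 1. *)
Lemma expr_truncn_cvg (p : R -> R) (l x : R) : 0 <= x ->
  p e @[e --> 0^'+] --> (1 : R) -> (p e - 1) / e @[e --> 0^'+] --> - l ->
  p e ^+ Num.truncn (x / e) @[e --> 0^'+] --> expR (- (l * x)).
Proof.
move=> x0 p1 pl; have nx := truncn_mul_cvg x0.
have nl : (Num.truncn (x / e))%:R * e * ((p e - 1) / e) @[e --> 0^'+] --> - (l * x).
  by rewrite mulrC -mulrN; exact: cvgM.
have nlp :
  (Num.truncn (x / e))%:R * e * ((p e - 1) / e) / p e @[e --> 0^'+] --> - (l * x).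
  rewrite -[X in _ --> X]divr1; apply: cvgM nl _.
  by apply: cvgV p1; rewrite oner_eq0.
apply: (@squeeze_cvgr _ _ _ _
  (fun e => expR ((Num.truncn (x / e))%:R * e * ((p e - 1) / e) / p e))
  (fun e => expR ((Num.truncn (x / e))%:R * e * ((p e - 1) / e)))).
- near=> e.
  have e0 : e != 0 by rewrite gt_eqF//; near: e; exact: nbhs_right_gt.
  have pe0 : 0 < p e by near: e; apply: (cvgr_gt _ p1).
  have -> : (Num.truncn (x / e))%:R * e * ((p e - 1) / e) =
    (Num.truncn (x / e))%:R * (p e - 1) by field.
  by rewrite -mulrA; exact: expr_exp_bounds.
- by apply: continuous_cvg nlp; exact: continuous_expR.
- by apply: continuous_cvg nl; exact: continuous_expR.
Unshelve. all: by end_near. Qed.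

End Holding.

(** * Irreducibility of P_eps, coercivity of Q, and the rate of convergence *)

Section BirthDeathChain.
Set Implicit Arguments.
Unset Strict Implicit.
Variables (R : realType) (k : nat) (q : 'I_k -> bdstate k -> R).
Hypothesis q0 : forall i m, 0 <= q i m.
Hypothesis irrQ : ct_irreducible (bdQ q).
Implicit Types m : bdstate k.

Lemma bdQ_gt0_flip m m' : m != m' -> 0 < bdQ q m m' ->
  exists2 i, m' = flip m i & 0 < q i m.
Proof.
rewrite /bdQ => /negPf -> Q0; apply: contrapT => nex.
move: Q0; rewrite big1 ?ltxx// => i /eqP mi.
apply/eqP; rewrite eq_le q0 andbT leNgt; apply/negP => qi.
by apply: nex; exists i.
Qed.

Lemma lambda_ge0 m : 0 <= lambda q m.
Proof. exact: sumr_ge0. Qed.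

(** As k > 0 there is a second state, and the first step of a path from [m] to it has positive
    rate. *)
Lemma lambda_gt0 m : (0 < k)%N -> 0 < lambda q m.
Proof.
move=> k0; have /connectP[[|m' p] /= mp] := irrQ m (flip m (Ordinal k0)).
  by move/eqP; rewrite (negPf (flip_neq _ _)).
move=> _; have /andP[/andP[mm' Q0] _] := mp.
have [i _ qi] := bdQ_gt0_flip mm' Q0.
by rewrite /lambda (bigD1 i)//= ltr_pwDl// sumr_ge0.
Qed.

Lemma Peps_flip_gt0 e m i : admissible q e -> 0 < q i m ->
  0 < Peps q e m (flip m i).
Proof.
move=> [e0 e1] qi; apply: prodr_gt0 => j _; rewrite ffunE.
have [->|_] := eqVneq j i; first by case: (m i); rewrite /= mulr_gt0.
by rewrite eqxx subr_gt0.
Qed.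

Lemma Peps_diag_gt0 e m : admissible q e -> 0 < Peps q e m m.
Proof. by move=> [e0 e1]; apply: prodr_gt0 => j _; rewrite eqxx subr_gt0. Qed.

Lemma Peps_stochastic e : admissible q e -> stochastic (Peps q e).
Proof.
move=> [e0 e1]; split=> [m m'|m]; last exact: Peps_sum.
apply: prodr_ge0 => i _; case: ifP => _; first by rewrite mulr_ge0// ltW.
by rewrite subr_ge0 ltW.
Qed.

Lemma Peps_irreducible e : admissible q e -> dt_irreducible (Peps q e).
Proof.
move=> ae m m'; apply: connect_sub (irrQ m m') => x y /andP[xy Qxy].
have [i -> qi] := bdQ_gt0_flip xy Qxy.
by apply: connect1; exact: Peps_flip_gt0.
Qed.

(* For small h the Euler step I + h Q is a stochastic matrix with positive
   diagonal, so its residual bound transfers to Q. *)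
Lemma bdQ_coercive : exists2 c : R, 0 <= c & forall v, \sum_m v m = 0 ->
  l1 v <= c * l1 (vmul v (bdQ q)).
Proof.
(* L exceeds every exit rate, so h lambda(m) < 1 for all [m]. *)
pose L : R := 1 + \sum_m lambda q m; pose h := L^-1.
have L0 : 0 < L by rewrite ltr_pwDl// sumr_ge0// => m _; exact: lambda_ge0.
have h0 : 0 < h by rewrite invr_gt0.
pose P m m' : R := (m == m')%:R + h * bdQ q m m'.
have Qoff m m' : m != m' -> 0 <= bdQ q m m'.
  by rewrite /bdQ => /negPf ->; exact: sumr_ge0.
have dP m : 0 < P m m.
  rewrite /P eqxx /bdQ eqxx mulrN subr_gt0 mulrC ltr_pdivrMr// mul1r.
  rewrite /L (bigD1 m)//= addrCA ltrDl ltr_pwDl// sumr_ge0// => m' _.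
  exact: lambda_ge0.
have sP : stochastic P.
  split=> [m m'|m].
    have [<-|mm'] := eqVneq m m'; first exact: ltW (dP m).
    by rewrite /P (negPf mm') add0r mulr_ge0 ?(ltW h0)// Qoff.
  rewrite big_split/= -mulr_sumr bdQ_sum mulr0 addr0 (bigD1 m)//= eqxx.
  by rewrite big1 ?addr0// => m'; rewrite eq_sym => /negPf ->.
have iP : dt_irreducible P.
  move=> m m'; apply: connect_sub (irrQ m m') => x y /andP[/negPf xy Qxy].
  by apply: connect1; rewrite /P xy add0r mulr_gt0.
have [c c0 cP] := l1_le_residual sP dP iP.
exists (c * h) => [|v /cP]; first by rewrite mulr_ge0// ltW.
(* The residual v P - v is h times v Q. *)
congr (_ <= _); rewrite -mulrA; congr (_ * _); rewrite /l1 mulr_sumr.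
apply: eq_bigr => b _; rewrite -[X in X * _](gtr0_norm h0) -normrM; congr `|_|.
rewrite /vmul /P; under eq_bigr do rewrite mulrDr.
rewrite big_split/= (bigD1 b)//= eqxx mulr1 big1 => [|a /negPf ->].
  rewrite addr0 [v b + _]addrC addrK mulr_sumr.
  by apply: eq_bigr => a _; rewrite mulrCA.
by rewrite mulr0.
Qed.

(* pi_eps (P_eps - I - eps Q) = - eps (pi_eps Q) and pi Q = 0 *)
Lemma stationary_l1_rate (pi : bdstate k -> R) :
  \sum_m pi m = 1 -> vmul pi (bdQ q) =1 (fun=> 0) ->
  exists2 C : R, 0 <= C & forall e p, 0 < e <= 1 -> stationary (Peps q e) p ->
    l1 (fun m => p m - pi m) <= C * e.
Proof.
move=> pi1 piQ; have [c c0 cQ] := bdQ_coercive.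
have [C C0 CP] := Peps_approx q.
exists (c * (C *+ #|bdstate k|)) => [|e p /andP[e0 e1] [p0 p1 pP]].
  by rewrite mulr_ge0// mulrn_wge0.
apply: le_trans (cQ _ _) _; first by rewrite sumrB p1 pi1 subrr.
(* It suffices to bound each of the [#|bdstate k|] coordinates by C e. *)
rewrite -mulrA ler_wpM2l// mulrnAl -sumr_const; apply: ler_sum => b _.
rewrite vmulBl piQ subr0 -(ler_pM2r e0) -[X in _ * X <= _](gtr0_norm e0) -normrM.
have -> : vmul p (bdQ q) b * e =
    - \sum_a p a * (Peps q e a b - (a == b)%:R - e * bdQ q a b).
  under eq_bigr do rewrite !mulrBr.
  have -> :
      \sum_a (p a * Peps q e a b - p a * (a == b)%:R - p a * (e * bdQ q a b)) =
      p b - p b - \sum_a p a * (e * bdQ q a b).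
    rewrite !sumrB pP; congr (_ - _ - _); rewrite (bigD1 b)//= eqxx mulr1.
    by rewrite big1 ?addr0// => a /negPf ->; rewrite mulr0.
  rewrite subrr sub0r opprK /vmul mulr_suml.
  by apply: eq_bigr => a _; rewrite mulrAC mulrA.
rewrite normrN; apply: le_trans (ler_norm_sum _ _ _) _.
(* The error is an average, with weights [p] of mass 1, of terms at most C e^2. *)
rewrite -[leRHS]mul1r -[X in X * _]p1 mulr_suml; apply: ler_sum => a _.
rewrite normrM ger0_norm// ler_wpM2l//.
by rewrite -mulrA -expr2 CP// e1 ltW.
Qed.

End BirthDeathChain.

(** * Ergodicity, stationary error, holding times and jump chain of P_eps *)

Theorem theorem3p1 (R : realType) (k : nat) (q : 'I_k -> bdstate k -> R)
    (pi : bdstate k -> R) :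
  (0 < k)%N ->
  (forall i m, 0 <= q i m) ->
  ct_irreducible (bdQ q) ->
  ct_limiting (bdQ q) pi ->
  (forall m, 0 < pi m) ->
  reversible (bdQ q) pi ->
  [/\
   (* (i) *)
   (forall eps : R, admissible q eps ->
      [/\ dt_irreducible (Peps q eps), aperiodic (Peps q eps),
          (exists! p : bdstate k -> R, stationary (Peps q eps) p) &
          forall p, stationary (Peps q eps) p -> dt_limiting (Peps q eps) p]),
   (* (ii) *)
   (forall pe : R -> bdstate k -> R,
      (forall eps : R, admissible q eps -> stationary (Peps q eps) (pe eps)) ->
      forall N : (bdstate k -> R) -> R, is_vnorm N ->
      exists C : R, exists2 d : R, 0 < d &
        forall eps : R, 0 < eps < d -> admissible q eps ->
          N (fun m => pe eps m - pi m) <= C * eps),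
   (* (iii) *)
   (forall (m : bdstate k) (x : R),
      holding_cdf (Peps q eps m m) eps x @[eps --> 0^'+] -->
        exp_cdf (lambda q m) x),
   (* (iv), m' = m^i *)
   (forall (m : bdstate k) (i : 'I_k),
      Ptilde q eps m (flip m i) @[eps --> 0^'+] --> q i m / lambda q m) &
   (* (iv), m' not a neighbour of m *)
   (forall m m' : bdstate k, m' != m -> (forall i, m' != flip m i) ->
      Ptilde q eps m m' @[eps --> 0^'+] --> 0)].
Proof.
move=> k0 q0 irrQ limpi pi0 revpi.
have pi1 : \sum_m pi m = 1 := ct_limiting_sum [ffun=> false] (bdQ_sum q) limpi.
have piQ : vmul pi (bdQ q) =1 (fun=> 0).
  (* Detailed balance turns a column sum of pi Q into a row sum of Q, which is 0. *)
  move=> b; rewrite /vmul; under eq_bigr do rewrite revpi.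
  by rewrite -mulr_sumr bdQ_sum mulr0.
have l0 m := lambda_gt0 q0 irrQ m k0.
split.
- move=> e ae; have sP := Peps_stochastic q0 ae.
  have dP m := Peps_diag_gt0 m ae; have iP := Peps_irreducible q0 irrQ ae.
  split=> //.
  (* Positive diagonal entries make 1 a return time, so the period divides 1. *)
  + move=> a d /(_ 1%N isT) ad; apply/eqP; rewrite -dvdn1; apply: ad.
    apply: (mpow_gt0_step (n := 0) (b := a) sP) => //=.
    by rewrite eqxx.
  + have [p sp] := stationary_exists [ffun=> false] sP dP iP.
    by exists p; split=> // p'; exact: stationary_unique.
  + move=> p sp; apply: mpow_cvg_fixed => // [|n]; first by case: sp.
    exact: stationary_mpow.
- move=> pe spe N vN; have [K K0 KP] := vnorm_le_l1 vN.
  have [C C0 CP] := stationary_l1_rate q0 irrQ pi1 piQ.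
  exists (K * C), 1 => // e /andP[e0 e1] ae.
  apply: le_trans (KP _) _; rewrite -mulrA ler_wpM2l//.
  by apply: CP (spe _ ae); rewrite e0 ltW.
- move=> m x; rewrite /exp_cdf.
  under eq_cvg do rewrite holding_cdfE.
  have [x0|x0] := leP 0 x.
    apply: cvgB; first exact: cvg_cst.
    apply: expr_truncn_cvg => //; first exact: Peps_diag_cvg1.
    by have := @Peps_slope R k q m m; rewrite /bdQ !eqxx.
  apply: cvg_near_cst; near=> e.
  have e0 : 0 < e by near: e; exact: nbhs_right_gt.
  (* For x < 0 the quotient is negative and its truncation is 0, so the distribution function is
     exactly 0. *)
  have /truncn0Pn -> : ~~ (1 <= x / e).
    by rewrite -ltNge (lt_trans _ (@ltr01 R))// pmulr_llt0// invr_gt0.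
  by rewrite expr0 subrr.
- by move=> m i; rewrite -(bdQ_flip q m i); apply: Ptilde_cvg; rewrite ?flip_neq.
- move=> m m' mm' nf; have := @Ptilde_cvg R k q m m' mm' (l0 m).
  by rewrite bdQ_nonneighbour// mul0r.
Unshelve. all: by end_near. Qed.
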